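(* Let $X$ be a compactum that is the union of countably many subspaces, each of which is countably tight and dense in $X$, and assume that $X^\omega$ is homogeneous. Then $|X|\le\mathfrak{c}$.
   Context: A compactum is a compact Hausdorff space. $X^\omega$ is the product of countably infinitely many copies of $X$ with the product topology. A space $Z$ is homogeneous if for all $x,y\in Z$ there is a homeomorphism $h:Z\to Z$ with $h(x)=y$. A space $Y$ is countably tight if whenever $A\subset Y$ and $y\in\overline{A}$ (closure in $Y$) there is a countable $B\subset A$ with $y\in\overline{B}$; a subspace is countably tight if it is so in its subspace topology. $\mathfrak{c}=2^{\omega}$. *)

(* Defs.v *)
From HB Require Import structures.
From mathcomp Require Import all_boot all_classical.
From mathcomp Require Import topology function_spaces.

Set Implicit Arguments.
Unset Strict Implicit.
Unset Printing Implicit Defensive.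

Local Open Scope classical_set_scope.

Definition compactum (X : topologicalType) : Prop :=
  compact [set: X] /\ hausdorff_space X.

Definition homeomorphism (Y Z : topologicalType) (h : Y -> Z) : Prop :=
  continuous h /\
  exists g : Z -> Y, [/\ continuous g, cancel h g & cancel g h].

Definition homogeneous (Z : topologicalType) : Prop :=
  forall x y : Z, exists h : Z -> Z, homeomorphism h /\ h x = y.

Definition countably_tight (Y : topologicalType) : Prop :=
  forall (A : set Y) (y : Y), closure A y ->
    exists B : set Y, [/\ B `<=` A, countable B & closure B y].

(* [set_type S] carries the subspace topology (initial for the inclusion),
   so the closures are taken in S; the library's [subspace S] is instead a
   topology on all of X, in which the points outside S are isolated. *)
Definition countably_tight_subspace (X : topologicalType) (S : set X) : Prop :=
  countably_tight (set_type S).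

(* [prod_topology] fixes the product topology explicitly: bare arrow types
   may receive other topologies, e.g. that of uniform convergence. *)
Definition omega_power (X : topologicalType) : topologicalType :=
  prod_topology (fun _ : nat => X).

(* Main.v *)
Require Import Defs.
From HB Require Import structures.
From mathcomp Require Import all_boot all_classical.
From mathcomp Require Import topology function_spaces.

(* Call a point of countable pi-character if some countable family of nonempty
   open sets has a member inside each of its neighbourhoods.
   In a compactum without such points, Shapirovskii's argument gives an
   uncountable independent family of separated pairs; countable tightness of
   countably many pieces covering the space forbids it, so every closed G_delta
   contains a point of countable pi-character. Since the pieces are dense, such
   a point is in the closure of a countable subset of each piece, and an
   omega_1-type construction then yields a nonempty closed G_delta inside the
   closure of a countable set. By homogeneity of the omega-th power both local
   properties hold at all points of X. A closing-off argument extracts from the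
   resulting cover by G_deltas a dense set M of size at most the continuum.
   Finally, fix a countable pi-base (B_k) at a constant point p of the power and
   homeomorphisms h_x taking p to the constant point x: if d_(x,k) in M is a
   first coordinate of a point of h_x(B_k), then x is determined by the sequence
   of the d_(x,k). *)

Set Implicit Arguments.
Unset Strict Implicit.
Unset Printing Implicit Defensive.

Local Open Scope classical_set_scope.
Local Open Scope card_scope.

(** * Compactness and closed G_delta sets *)

Lemma compact_bigcap_directed (X : topologicalType) (K : set X) (I : Type)
    (D : set I) (F : I -> set X) :
  compact K -> D !=set0 -> (forall i, D i -> closed (F i)) ->
  (forall i, D i -> K `&` F i !=set0) ->
  (forall i j, D i -> D j -> exists2 k, D k & F k `<=` F i `&` F j) ->
  K `&` \bigcap_(i in D) F i !=set0.
Proof.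
move=> cK [i0 Di0] cF KF dF.
have FF : Filter (filter_from D (fun i => K `&` F i)).
  apply: filter_from_filter; first by exists i0.
  move=> i j Di Dj; have [k Dk kij] := dF _ _ Di Dj.
  by exists k => // x [Kx /kij[]].
have PF : ProperFilter (filter_from D (fun i => K `&` F i)).
  by apply: filter_from_proper => i Di; exact: KF.
have [|x [Kx clx]] := cK _ PF; first by exists i0.
exists x; split => // i Di; apply: (cF i Di) => B Bx.
have [|y [[_ Fy] By]] := clx (K `&` F i) B _ Bx; first by exists i.
by exists y.
Qed.

Lemma compact_bigcap_finite (X : topologicalType) (K : set X) (I : Type)
    (A : set I) (F : I -> set X) :
  compact K -> (forall i, A i -> closed (F i)) ->
  (forall L, L `<=` A -> finite_set L -> K `&` \bigcap_(i in L) F i !=set0) ->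
  K `&` \bigcap_(i in A) F i !=set0.
Proof.
move=> cK cF KF.
have [|L [LA _]|L [LA fL]|L M [LA fL] [MA fM]|x [Kx Fx]] :=
    @compact_bigcap_directed X K _ [set L | L `<=` A /\ finite_set L]
      (fun L => \bigcap_(i in L) F i) cK.
- by exists set0; split.
- by apply: closed_bigI => i /LA; exact: cF.
- exact: KF.
- exists (L `|` M); last by rewrite bigcap_setU.
  by split; [rewrite subUset | rewrite finite_setU].
- exists x; split => // i Ai; apply: (Fx [set i]) => //.
  by split => // _ ->.
Qed.

Lemma compact_bigcap_sub (X : topologicalType) (K U : set X) (I : Type)
    (A : set I) (F : I -> set X) :
  compact K -> open U -> (forall i, A i -> closed (F i)) ->
  K `&` \bigcap_(i in A) F i `<=` U ->
  exists L, [/\ L `<=` A, finite_set L & K `&` \bigcap_(i in L) F i `<=` U].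
Proof.
move=> cK oU cF KFU; apply: contrapT => noL.
have [||L LA fL|x [[Kx nUx] Fx]] :=
    @compact_bigcap_finite X (K `&` ~` U) I A F.
- by apply: compact_closedI => //; exact: open_closedC.
- by [].
- apply: contrapT => KUL0; apply: noL; exists L; split => // x [Kx Lx].
  by apply: contrapT => Ux; apply: KUL0; exists x.
- by apply: nUx; exact: KFU.
Qed.

Lemma compact_finite_subcover (X : topologicalType) (K : set X) (I : Type)
    (A : set I) (U : I -> set X) :
  compact K -> (forall i, A i -> open (U i)) -> K `<=` \bigcup_(i in A) U i ->
  exists L, [/\ L `<=` A, finite_set L & K `<=` \bigcup_(i in L) U i].
Proof.
move=> cK oU KU.
have [|||L [LA fL KL]] := @compact_bigcap_sub X K set0 I A (fun i => ~` U i) cK.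
- exact: open0.
- by move=> i Ai; exact/open_closedC/oU.
- by move=> x [/KU[i Ai Uix] /(_ i Ai)].
- exists L; split => // x Kx; apply: contrapT => nU.
  by apply: (KL x); split => // i Li Uix; apply: nU; exists i.
Qed.

Lemma compactum_closed (X : topologicalType) (K : set X) :
  compactum X -> closed K -> compact K.
Proof. by move=> [cX _] clK; exact: (subclosed_compact clK cX). Qed.

Lemma compactum_regular (X : topologicalType) (x : X) (V : set X) :
  compactum X -> open V -> V x ->
  exists W, [/\ open W, W x & closure W `<=` V].
Proof.
move=> [cX hX] oV Vx.
have [|W Wx WV] := @compact_regular X x setT hX cX filterT V.
  exact/open_nbhs_nbhs.
exists W°; split; [exact: open_interior | exact: Wx |].
by apply: subset_trans WV; apply: closureS; exact: interior_subset.
Qed.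

Lemma open_bigcap_finite (X : topologicalType) (I : Type) (L : set I)
    (F : I -> set X) :
  finite_set L -> (forall i, L i -> open (F i)) -> open (\bigcap_(i in L) F i).
Proof.
elim/Pchoice: I => I in L F *.
move=> /finite_fsetP[M ->] oF; rewrite openE => x Fx.
by apply: filter_bigI => i iM; apply: open_nbhs_nbhs; split; [exact: oF|exact: Fx].
Qed.

(** The closure condition makes the intersection closed as well as G_delta; in a normal space every
    closed G_delta set arises so. *)
Definition tower (X : topologicalType) (Q : nat -> set X) : Prop :=
  forall n, open (Q n) /\ closure (Q n.+1) `<=` Q n.

Definition closed_Gdelta (X : topologicalType) (G : set X) : Prop :=
  exists2 Q, tower Q & G = \bigcap_n Q n.

Lemma tower_sub (X : topologicalType) (Q : nat -> set X) m n :
  tower Q -> (m <= n)%N -> Q n `<=` Q m.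
Proof.
move=> tQ; elim: n => [|n IH]; first by rewrite leqn0 => /eqP ->.
rewrite leq_eqVlt => /predU1P[-> //|]; rewrite ltnS => /IH.
apply: subset_trans; apply: subset_trans (proj2 (tQ n)).
exact: subset_closure.
Qed.

Lemma closed_Gdelta_closed (X : topologicalType) (G : set X) :
  closed_Gdelta G -> closed G.
Proof.
move=> [Q tQ ->] x clx n _; apply: (proj2 (tQ n)).
by apply: closureS clx => y /(_ n.+1); apply.
Qed.

Lemma compactum_tower (X : topologicalType) (x : X) (V : set X) :
  compactum X -> open V -> V x ->
  exists Q, [/\ tower Q, forall n, Q n x & Q 0 `<=` V].
Proof.
move=> cX oV Vx.
have /choice[f fP] : forall U : set X, exists W, open U -> U x ->
    [/\ open W, W x & closure W `<=` U].
  move=> U; have [[oU Ux]|nU] := pselect (open U /\ U x).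
    by have [W ?] := compactum_regular cX oU Ux; exists W.
  by exists set0 => oU Ux; case: nU.
pose Q n := iter n f V.
have QP n : open (Q n) /\ Q n x.
  by elim: n => [//|n [oQ Qx]]; have [] := fP _ oQ Qx.
exists Q; split => //; last by move=> n; case: (QP n).
by move=> n; have [oQ Qx] := QP n; split => //; have [] := fP _ oQ Qx.
Qed.

Lemma closed_Gdelta_bigcap (X : topologicalType) (G : nat -> set X) :
  (forall i, closed_Gdelta (G i)) -> closed_Gdelta (\bigcap_i G i).
Proof.
move=> gG; have /choice[Q QP] : forall i, exists Q, tower Q /\ G i = \bigcap_n Q n.
  by move=> i; have [Q] := gG i; exists Q.
exists (fun n => \bigcap_(i in `I_n.+1) Q i n) => [n|].
  split.
    by apply: open_bigcap_finite => // i _; case: (proj1 (QP i) n).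
  move=> x clx i /= ltin; apply: (proj2 (proj1 (QP i) n)).
  by apply: closureS clx => y /(_ i) Qy; apply: Qy; rewrite /= ltnS ltnW.
apply/seteqP; split=> x /= Gx.
  by move=> n _ i _; have := Gx i I; rewrite (proj2 (QP i)); exact.
move=> i _; rewrite (proj2 (QP i)) => n _.
apply: (@tower_sub _ _ _ (maxn n i) (proj1 (QP i)) (leq_maxl _ _)).
by apply: Gx => //=; rewrite ltnS leq_maxr.
Qed.

Lemma closed_GdeltaI (X : topologicalType) (G H : set X) :
  closed_Gdelta G -> closed_Gdelta H -> closed_Gdelta (G `&` H).
Proof.
move=> gG gH.
have -> : G `&` H = \bigcap_i (if i == 0 then G else H).
  apply/seteqP; split=> [x [Gx Hx] i _|x GHx]; first by case: ifP.
  by split; [exact: (GHx 0) | exact: (GHx 1)].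
by apply: closed_Gdelta_bigcap => i; case: ifP.
Qed.

(** Tightness of the subspace [S] with closures taken in [X]: a closure in [S] is the trace of the
    closure in [X]. *)
Definition ctight (X : topologicalType) (S : set X) : Prop :=
  forall A y, A `<=` S -> S y -> closure A y ->
    exists B, [/\ B `<=` A, countable B & closure B y].

Lemma countably_tight_subspace_ctight (X : topologicalType) (S : set X) :
  countably_tight_subspace S -> ctight S.
Proof.
move=> tS A y AS Sy clA.
pose y' : S := SigSub (mem_set Sy).
have [|B [BA cB clB]] := tS (set_val @^-1` A) y'.
  move=> U; rewrite nbhsE => -[_ [[O oO <-] Oy] OU].
  have [z [Az Oz]] := clA O (open_nbhs_nbhs (conj oO Oy)).
  by exists (SigSub (mem_set (AS z Az))); split => //; exact: OU.
exists (set_val @` B); split.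
- by move=> _ [b Bb <-]; exact: BA.
- exact: card_le_trans (card_image_le _ _) cB.
- move=> U /nbhs_interior Uy.
  have [|b [Bb Ub]] := clB (set_val @^-1` U°).
    apply: open_nbhs_nbhs; split; last exact: (nbhs_singleton Uy).
    by exists U° => //; exact: open_interior.
  by exists (set_val b); split; [exists b | exact: interior_subset].
Qed.

Lemma countable_range (T : Type) (A : set T) :
  countable A -> A !=set0 -> exists s : nat -> T, A = range s.
Proof.
move=> /countable_injP[f fI] [y Ay].
have /choice[s sP] : forall k, exists x, A x /\ forall z, A z -> f z = k -> z = x.
  move=> k; have [[w [Aw fw]]|nw] := pselect (exists w, A w /\ f w = k).
    by exists w; split => // v Av fv; apply: fI; rewrite ?inE // fv fw.
  by exists y; split => // w Aw fw; case: nw; exists w.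
exists s; apply/seteqP; split=> [w Aw|_ [k _ <-]]; last by case: (sP k).
by exists (f w) => //; apply/esym; exact: (proj2 (sP (f w))).
Qed.

(** * Countable tightness against uncountable independent families *)

Lemma countable_inj_on (T U : Type) (A : set T) (B : set U) (f : T -> U) :
  countable B -> (forall x, A x -> B (f x)) ->
  (forall x y, A x -> A y -> f x = f y -> x = y) -> countable A.
Proof.
move=> /countable_injP[g gI] AB fI; apply/countable_injP; exists (g \o f).
move=> x y /set_mem Ax /set_mem Ay /= fxy; apply: fI => //.
by apply: gI => //; apply/mem_set/AB.
Qed.

Lemma countableU (T : Type) (A B : set T) :
  countable A -> countable B -> countable (A `|` B).
Proof.
move=> cA cB; rewrite (_ : A `|` B = \bigcup_(b in [set: bool]) (if b then A else B)).
  by apply: bigcup_countable => // -[].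
apply/seteqP; split=> [x [?|?]|x [[] _ ?]].
- by exists true.
- by exists false.
- by left.
- by right.
Qed.

(* A maximal partial involution without fixed points misses at most one point
   of [A]; its pairs split [A]. *)
Lemma uncountable_split (I : Type) (A : set I) :
  ~ countable A ->
  exists A0 A1, [/\ A0 `<=` A, A1 `<=` A, A0 `&` A1 = set0,
    ~ countable A0 & ~ countable A1].
Proof.
move=> uA.
pose compat (p q : I * I) :=
  [/\ p.1 <> q.2, p.1 = q.1 -> p = q & p.2 = q.2 -> p = q].
pose P (G : set (I * I)) := (forall p, G p -> A p.1 /\ A p.2) /\
  (forall p q, G p -> G q -> compat p q).
have [G [[GA Gc] Gmax]] : exists G, P G /\ forall H, G `<` H -> ~ P H.
  apply: Zorn_bigcup => F FP Ftot; split; first by move=> p [G /FP[+ _]]; apply.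
  move=> p q [G FG Gp] [H FH Hq].
  by have [GH|HG] := Ftot _ _ FG FH;
    [apply: (proj2 (FP _ FH)) => //; exact: GH
    |apply: (proj2 (FP _ FG)) => //; exact: HG].
have uG : ~ countable G.
  move=> cG; apply: uA.
  pose R := A `\` (fst @` G `|` snd @` G).
  have R1 a b : R a -> R b -> a = b.
    move=> [Aa Ga] [Ab Gb]; apply: contrapT => ab.
    apply: (Gmax (G `|` [set (a, b)])).
      split; first by left.
      move=> /(_ (a, b)) /(_ (or_intror erefl)) Gab.
      by apply: Ga; left; exists (a, b).
    split=> [p [/GA //|-> //]|p q [Gp|->] [Gq|->]]; rewrite /compat /=.
    - exact: Gc.
    - split => [pb|pa|pb].
      + by apply: Gb; left; exists p.
      + by case: Ga; left; exists p.
      + by case: Gb; right; exists p.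
    - split => [pb|pa|pb].
      + by apply: Ga; right; exists q.
      + by case: Ga; left; exists q.
      + by case: Gb; right; exists q.
    - by split.
  have -> : A = (fst @` G `|` snd @` G) `&` A `|` R.
    apply/seteqP; split=> [a Aa|a [[]//|[]//]].
    by have [Ga|Ga] := pselect ((fst @` G `|` snd @` G) a); [left|right].
  apply: countableU.
    apply: (@sub_countable _ _ _ (fst @` G `|` snd @` G)).
      by apply: subset_card_le; exact: subIsetl.
    by apply: countableU; apply: (card_le_trans (card_image_le _ _)).
  apply: (@countable_inj_on _ unit R setT (fun=> tt)) => // a b Ra Rb _.
  exact: R1.
exists (fst @` G), (snd @` G); split.
- by move=> _ [p /GA[? ?] <-].
- by move=> _ [p /GA[? ?] <-].
- apply/seteqP; split=> // x [[p Gp <-] [q Gq qp]].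
  by have [] := Gc _ _ Gp Gq; rewrite qp.
- move=> cG; apply: uG; apply: (countable_inj_on (f := fst) cG).
    by move=> p Gp; exists p.
  by move=> p q Gp Gq; have [_ + _] := Gc _ _ Gp Gq; apply.
- move=> cG; apply: uG; apply: (countable_inj_on (f := snd) cG).
    by move=> p Gp; exists p.
  by move=> p q Gp Gq; have [_ _ +] := Gc _ _ Gp Gq; apply.
Qed.

(** For [K] closed and all [F i true], [F i false] closed and disjoint, this says that a closed
    subset of [K] maps onto the Cantor cube [2^A] by recording sides. *)
Definition rich (X : topologicalType) (I : Type) (F : I -> bool -> set X)
    (K : set X) (A : set I) : Prop :=
  forall e : I -> bool, K `&` \bigcap_(i in A) F i (e i) !=set0.

(** Zorn's lemma applies to the open sets that can be removed from [K]: by compactness the union of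
    a chain of them can be removed too. *)
Lemma rich_minimal (X : topologicalType) (I : Type) (F : I -> bool -> set X)
    (K : set X) (A : set I) :
  compactum X -> (forall i b, closed (F i b)) -> closed K -> rich F K A ->
  exists M, [/\ M `<=` K, closed M, rich F M A &
    forall U, open U -> M `&` U !=set0 -> ~ rich F (M `\` U) A].
Proof.
move=> cX cF cK rK.
pose P (U : set X) := open U /\ rich F (K `\` U) A.
have [U [[oU rU] Umax]] : exists U, P U /\ forall V, U `<` V -> ~ P V.
  apply: Zorn_bigcup => H HP Htot; split.
    by apply: bigcup_open => U /HP[].
  move=> e; have [H0|/set0P H0] := eqVneq H set0.
    by rewrite H0 bigcup_set0 setD0.
  have [||U V HU HV|x [Kx Hx]] := @compact_bigcap_directed X K _ H
      (fun U => ~` U `&` \bigcap_(i in A) F i (e i)) (compactum_closed cX cK) H0.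
  - move=> U /HP[oU _]; apply: closedI; first exact: open_closedC.
    exact: closed_bigI.
  - by move=> U /HP[_ /(_ e)]; rewrite setDE setIA.
  - have [UV|VU] := Htot _ _ HU HV.
      by exists V => // x [Vx Fx]; split; split => // /UV.
    by exists U => // x [Ux Fx]; split; split => // /VU.
  - have [U0 HU0] := H0.
    exists x; split; last by case: (Hx _ HU0).
    by split => // -[U HU Ux]; case: (Hx _ HU).
exists (K `\` U); split => //.
  by rewrite setDE; apply: closedI => //; exact: open_closedC.
move=> V oV [x [[Kx nUx] Vx]] rV; apply: (Umax (U `|` V)).
  by split; [left | move=> /(_ x (or_intror Vx))].
split; first exact: openU.
by move: rV; rewrite !setDE setCU setIA.
Qed.

Lemma rich_restrict (X : topologicalType) (I : Type) (F : I -> bool -> set X)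
    (K : set X) (A B : set I) (e : I -> bool) :
  rich F K A -> B `<=` A -> rich F (K `&` \bigcap_(i in B) F i (e i)) (A `\` B).
Proof.
move=> rK BA d; pose s i := if `[< B i >] then e i else d i.
have [x [Kx Fx]] := rK s; exists x; split.
  split => // i Bi; have := Fx i (BA i Bi); rewrite /s.
  by case: asboolP.
by move=> i [Ai nBi]; have := Fx i Ai; rewrite /s; case: asboolP.
Qed.

Lemma rich_subset (X : topologicalType) (I : Type) (F : I -> bool -> set X)
    (K : set X) (A B : set I) : rich F K A -> B `<=` A -> rich F K B.
Proof.
move=> rK BA e; have [x [Kx Fx]] := rK e; exists x; split => // i /BA; exact: Fx.
Qed.

Lemma uncountableD (T : Type) (A B : set T) :
  ~ countable A -> countable B -> ~ countable (A `\` B).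
Proof.
move=> uA cB cAB; apply: uA; apply: (@sub_countable _ _ _ (A `\` B `|` B)).
  apply: subset_card_le => x Ax; have [?|?] := pselect (B x); first by right.
  by left.
exact: countableU.
Qed.

(* If [S] met all smaller rich sets, then, in a minimal rich set, the points of
   [S] lying in [F i true] for all but countably many [i] in [A0] would
   accumulate at a point of [S] lying in [F i false] for all [i] in [A0], while
   no countable set of them does. *)
Lemma ctight_rich (X : topologicalType) (I : Type) (F : I -> bool -> set X)
    (K S : set X) (A : set I) :
  compactum X -> ctight S -> (forall i b, closed (F i b)) ->
  (forall i, F i true `&` F i false = set0) ->
  closed K -> ~ countable A -> rich F K A ->
  exists K' A', [/\ K' `<=` K, closed K', ~ countable A', rich F K' A' &
    K' `&` S = set0].
Proof.
move=> cX tS cF dF cK0 uA rK0; apply: contrapT => noKA.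
have hitS K' A' : K' `<=` K -> closed K' -> ~ countable A' -> rich F K' A' ->
    K' `&` S !=set0.
  move=> K'K cK' uA' rK'; apply: contrapT => /nonemptyPn K'S.
  by apply: noKA; exists K', A'.
have [M [MK cM rM Mmin]] := rich_minimal cX cF cK0 rK0.
(* [A0] carries the accumulation argument, while [A1] keeps uncountably many indices free once the
   sides over [A0] are fixed, so that [hitS] still applies. *)
have [A0 [A1 [A0A A1A A01 uA0 uA1]]] := uncountable_split uA.
have A1D : A1 `<=` A `\` A0.
  by move=> i A1i; split; [exact: A1A | move=> A0i; rewrite -[False]/(set0 i) -A01].
pose C (B : set I) := M `&` \bigcap_(i in A0 `\` B) F i true.
have cC B : closed (C B) by apply: closedI => //; exact: closed_bigI.
have [p [[Mp p0] Sp]] : (M `&` \bigcap_(i in A0) F i false) `&` S !=set0.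
  apply: (hitS _ A1) => //; first by move=> x [/MK].
    by apply: closedI => //; exact: closed_bigI.
  apply: rich_subset A1D; exact: (@rich_restrict _ _ _ _ _ _ (fun=> false)).
pose Y := [set x | S x /\ exists2 B, countable B & C B x].
have [|||E [EY cE clE]] := tS Y p; first by move=> x [].
- exact: Sp.
- move=> U; rewrite nbhsE => -[V [oV Vp] VU].
  (* Removing [V] destroys richness, so some choice [e] confines its points of [M] to [V]; by
     compactness finitely many sides [L] already do. Then [d] follows [e] on [L] and takes the true
     sides on the rest of [A0]. *)
  have /existsNP[e nVe] : ~ rich F (M `\` V) A by apply: Mmin => //; exists p.
  have [|L [LA fL LV]] := @compact_bigcap_sub X M V I A (fun i => F i (e i))
      (compactum_closed cX cM) oV (fun i _ => cF i (e i)).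
    move=> x [Mx Fx]; apply: contrapT => nVx; apply: nVe; exists x; split => //.
  pose d i := if `[< L i >] then e i else true.
  have [x [[Mx dx] Sx]] : (M `&` \bigcap_(i in L `|` A0) F i (d i)) `&` S !=set0.
    apply: (hitS _ (A1 `\` L)); first by move=> x [/MK].
    + by apply: closedI => //; exact: closed_bigI.
    + by apply: uncountableD => //; exact: finite_set_countable.
    + apply: (@rich_subset _ _ _ _ (A `\` (L `|` A0))).
        by apply: rich_restrict => //; rewrite subUset.
      move=> i [A1i nLi]; have [Ai nA0i] := A1D i A1i; split => // -[] //.
  exists x; split; last first.
    apply/VU/LV; split => // i Li; have := dx i (or_introl Li); rewrite /d.
    by case: asboolP.
  split => //; exists L; first exact: finite_set_countable.
  split => // i [A0i nLi]; have := dx i (or_intror A0i); rewrite /d.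
  by case: asboolP.
- have /choice[B BP] : forall x, exists B, E x -> countable B /\ C B x.
    move=> x; have [/EY[_ [B cB CB]]|nE] := pselect (E x); first by exists B.
    by exists set0.
  pose BE := \bigcup_(x in E) B x.
  have cBE : countable BE by apply: bigcup_countable => // x /BP[].
  have /infinite_setN0[i [A0i nBi]] : infinite_set (A0 `\` BE).
    by move=> /finite_set_countable; exact: uncountableD.
  have [_ Cp] : C BE p.
    apply: (cC BE); apply: closureS clE => x Ex; have [_ [Mx CBx]] := BP x Ex.
    by split => // j [A0j nBj]; apply: CBx; split => // Bj; apply: nBj; exists x.
  have : (F i true `&` F i false) p by split; [exact: Cp | exact: p0].
  by rewrite dF.
Qed.

(** Rich closed sets are shrunk repeatedly, [s n.+1] missing [D n]; a point common to all of them,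
    given by compactness, would lie in no [D n]. *)
Lemma sigma_ctight_not_rich (X : topologicalType) (I : Type)
    (F : I -> bool -> set X) (D : nat -> set X) (K : set X) (A : set I) :
  compactum X -> (forall n, ctight (D n)) -> \bigcup_n D n = setT ->
  (forall i b, closed (F i b)) -> (forall i, F i true `&` F i false = set0) ->
  closed K -> ~ countable A -> ~ rich F K A.
Proof.
move=> cX tD DT cF dF cK uA rK.
pose good (p : set X * set I) := [/\ closed p.1, ~ countable p.2 & rich F p.1 p.2].
have /choice[f fP] : forall np : nat * (set X * set I), exists q, good np.2 ->
    [/\ good q, q.1 `<=` np.2.1 & q.1 `&` D np.1 = set0].
  move=> [n [K' A']] /=; have [[c u r]|ng] := pselect (good (K', A')).
    by have [L [B [LK cL uB rL LD]]] := ctight_rich cX (tD n) cF dF c u r; exists (L, B).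
  by exists (K', A').
pose fix s n : set X * set I := if n is m.+1 then f (m, s m) else (K, A).
have gs n : good (s n) by elim: n => [//|n gn]; have [] := fP (n, s n) gn.
have sS m n : (m <= n)%N -> (s n).1 `<=` (s m).1.
  elim: n => [|n IH]; first by rewrite leqn0 => /eqP ->.
  rewrite leq_eqVlt => /predU1P[-> //|]; rewrite ltnS => /IH.
  by apply: subset_trans; have [] := fP (n, s n) (gs n).
have [||n _|m n _ _|x [_ sx]] := @compact_bigcap_directed X setT _ setT
    (fun n => (s n).1) (proj1 cX).
- by exists 0.
- by move=> n _; case: (gs n).
- by rewrite setTI; have [_ _ /(_ (fun=> true))[x [sx _]]] := gs n; exists x.
- exists (maxn m n) => // x sx; split.
    exact: (sS _ _ (leq_maxl m n)).
  exact: (sS _ _ (leq_maxr m n)).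
- have [n _ Dx] : (\bigcup_n D n) x by rewrite DT.
  have [_ _] := fP (n, s n) (gs n); rewrite -subset0 => /(_ x); apply.
  by split => //; exact: (sx n.+1).
Qed.

(** * Points of countable pi-character *)

Lemma finite_sub_chain (T : Type) (F : set (set T)) (L : set T) :
  F !=set0 -> total_on F subset -> finite_set L -> L `<=` \bigcup_(G in F) G ->
  exists2 G, F G & L `<=` G.
Proof.
elim/Peq: T => T in F L *.
move=> [G0 FG0] Ftot /finite_seqP[s ->].
elim: s => [|x s IH] sF; first by exists G0.
have [|G FG sG] := IH; first by move=> y ys; apply: sF; rewrite /= inE ys orbT.
have [|H FH Hx] := sF x; first by rewrite /= mem_head.
have [GH|HG] := Ftot _ _ FG FH.
  by exists H => // y; rewrite /= inE => /predU1P[-> //|/sG /GH].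
by exists G => // y; rewrite /= inE => /predU1P[->|/sG //]; exact: HG.
Qed.

Definition separated_pair (X : topologicalType) (J : bool -> set X) : Prop :=
  (forall b, open (J b)) /\ closure (J true) `&` closure (J false) = set0.

Definition pairs (X : topologicalType) : Type :=
  {J : bool -> set X | separated_pair J}.

Definition pair_side (X : topologicalType) (J : pairs X) (b : bool) : set X :=
  sval J b.

Definition independent (X : topologicalType) (K S : set X)
    (J : set (pairs X)) : Prop :=
  forall (e : pairs X -> bool) L, L `<=` J -> finite_set L ->
    K `&` (S `&` \bigcap_(i in L) pair_side i (e i)) !=set0.

(** Independence has finite character; that [K] meets [S] takes care of the empty chain. *)
Lemma independent_maximal (X : topologicalType) (K S : set X) :
  K `&` S !=set0 ->
  exists J, independent K S J /\ forall H, J `<` H -> ~ independent K S H.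
Proof.
move=> KS; apply: Zorn_bigcup => F FI Ftot e L LF fL.
have [F0|/set0P F0] := eqVneq F set0.
  move: LF; rewrite F0 bigcup_set0 subset0 => ->.
  by rewrite bigcap_set0 setIT.
have [G FG LG] := finite_sub_chain F0 Ftot fL LF.
exact: (FI _ FG).
Qed.

(** Compactness passes from finite choices of open sides to arbitrary choices of their closures, so
    an uncountable [J] would be [rich]. *)
Lemma independent_countable (X : topologicalType) (D : nat -> set X)
    (K S : set X) (J : set (pairs X)) :
  compactum X -> (forall n, ctight (D n)) -> \bigcup_n D n = setT -> closed K ->
  independent K S J -> countable J.
Proof.
move=> cX tD DT cK iJ; apply: contrapT => uJ.
apply: (@sigma_ctight_not_rich X (pairs X) (fun i b => closure (pair_side i b))
  D K J cX tD DT _ _ cK uJ).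
- by move=> i b; exact: closed_closure.
- by move=> [i [? ?]].
- move=> e; apply: compact_bigcap_finite.
  + exact: compactum_closed.
  + by move=> i _; exact: closed_closure.
  + move=> L LJ fL; have [x [Kx [_ Lx]]] := iJ e L LJ fL.
    by exists x; split => // i Li; exact/subset_closure/Lx.
Qed.

Lemma open_pair_side (X : topologicalType) (J : pairs X) b : open (pair_side J b).
Proof. by case: J => J [oJ ?]; exact: oJ. Qed.

Lemma pair_side_disjoint (X : topologicalType) (J : pairs X) x :
  pair_side J true x -> pair_side J false x -> False.
Proof.
case: J => J [? J0]; rewrite /pair_side /= => /subset_closure Jt /subset_closure Jf.
by rewrite -[False]/(set0 x) -J0.
Qed.

Lemma compactum_pair (X : topologicalType) (V : set X) (x : X) :
  compactum X -> open V -> V x ->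
  exists J : pairs X, pair_side J false x /\ ~` V `<=` pair_side J true.
Proof.
move=> cX oV Vx.
have [W [oW Wx WV]] := compactum_regular cX oV Vx.
have [U [oU Ux UW]] := compactum_regular cX oW Wx.
have sJ : separated_pair (fun b : bool => if b then ~` closure W else U).
  split; first by case=> //; exact/closed_openC/closed_closure.
  apply/seteqP; split=> // y [cWy /UW Wy].
  have [z [+ Wz]] := cWy W (open_nbhs_nbhs (conj oW Wy)).
  by apply; exact: subset_closure.
exists (exist _ _ sJ); split => // y nVy /WV; exact: nVy.
Qed.

Definition pi_base_at (X : topologicalType) (K : set X) (x : X)
    (U : nat -> set X) : Prop :=
  (forall i, open (U i) /\ K `&` U i !=set0) /\
  forall V, open V -> V x -> exists i, K `&` U i `<=` V.

(* Otherwise, [O] enumerates a countable family of open sets, closed under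
   refinement along maximal (hence countable) independent families. Each point
   of [K] has a pair whose second side meets every member of [O]; by compactness
   the first side of one such pair meets all refinements of some [O s0], so this
   pair extends the maximal independent family below [O s0]. *)
Lemma sigma_ctight_pi_base (X : topologicalType) (D : nat -> set X) (K : set X) :
  compactum X -> (forall n, ctight (D n)) -> \bigcup_n D n = setT ->
  closed K -> K !=set0 ->
  exists2 x, K x & exists U, pi_base_at K x U.
Proof.
move=> cX tD DT cK [x0 Kx0]; apply: contrapT => noPi.
have /choice[M MP] : forall S, exists J, K `&` S !=set0 ->
    independent K S J /\ forall H, J `<` H -> ~ independent K S H.
  move=> S; have [/independent_maximal[J ?]|] := pselect (K `&` S !=set0).
    by exists J.
  by exists set0.
have /choice[c cP] : forall S, exists c : pairs X -> nat, K `&` S !=set0 ->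
    forall i j, M S i -> M S j -> c i = c j -> i = j.
  move=> S; have [/MP[iM _]|] := pselect (K `&` S !=set0).
    have /countable_injP[f fI] := independent_countable cX tD DT cK iM.
    by exists f => _ i j Mi Mj; apply: fI; exact: mem_set.
  by exists (fun=> 0).
(* When [K] meets [S], [E S (n, b)] is side [b] of the pair numbered [n] in [M S], if any. Each
   letter of a word refines the previous set by finitely many such sides; as there are countably
   many words, [O] is a countable family. *)
pose E S (p : nat * bool) :=
  \bigcup_(J in [set J | M S J /\ c S J = p.1]) pair_side J p.2.
pose fix O (s : seq (seq (nat * bool))) : set X :=
  if s is l :: s' then O s' `&` \bigcap_(p in [set` l]) E (O s') p else setT.
have oO s : open (O s).
  elim: s => [|l s IH] /=; first exact: openT.
  apply: openI => //; apply: open_bigcap_finite; first exact: finite_seq.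
  by move=> p _; apply: bigcup_open => J _; exact: open_pair_side.
have /choice[P PP] : forall x, exists J : pairs X, K x -> pair_side J false x /\
    forall s, K `&` O s !=set0 -> K `&` (O s `&` pair_side J true) !=set0.
  move=> x; have [Kx|nKx] := pselect (K x); last first.
    by have [J _] := compactum_pair cX openT (I : setT x0); exists J.
  (* [U] enumerates the sets [O s] that meet [K], with default [setT]; it is not a pi-base at [x],
     and this yields [V]. *)
  pose U n : set X := if unpickle n is Some s then
    if `[< K `&` O s !=set0 >] then O s else setT else setT.
  have UP n : open (U n) /\ K `&` U n !=set0.
    have T0 : open [set: X] /\ K `&` setT !=set0.
      by split; [exact: openT | exists x].
    by rewrite /U; case: unpickle => // s; case: asboolP.
  have [V [oV Vx noV]] : exists V, [/\ open V, V x &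
      forall s, K `&` O s !=set0 -> K `&` (O s `&` ~` V) !=set0].
    apply: contrapT => noV; apply: noPi; exists x => //; exists U; split => //.
    move=> V oV Vx; apply: contrapT => noi; apply: noV; exists V; split => // s Ks.
    apply: contrapT => KsV; apply: noi; exists (pickle s).
    rewrite /U pickleK; case: asboolP => // _ y [Ky Oy].
    by apply: contrapT => nVy; apply: KsV; exists y.
  have [J [Jx JV]] := compactum_pair cX oV Vx.
  exists J => _; split => // s /noV[y [Ky [Oy nVy]]].
  by exists y; split => //; split => //; exact: JV.
have [|x Kx|L [LK /finite_seqP[r Lr] KL]] := @compact_finite_subcover X K X K
  (fun x => pair_side (P x) false) (compactum_closed cX cK).
- by move=> x _; exact: open_pair_side.
- by exists x => //; case: (PP x Kx).
(* Induction along the finite cover: a set [O s'] inside [O s] that meets [K], but not in the false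
   side of [P x], allows [x] to be dropped. As the sets keep meeting [K], the cover never becomes
   empty. *)
have [x [s0 [Kx Ks0 s0P]]] : exists x s0, [/\ K x, K `&` O s0 !=set0 &
    forall s, O s `<=` O s0 -> K `&` O s !=set0 ->
      K `&` (O s `&` pair_side (P x) false) !=set0].
  have rK : forall x, x \in r -> K x by move=> x xr; apply: LK; rewrite Lr.
  have {}KL : K `&` O [::] `<=` \bigcup_(x in [set` r]) pair_side (P x) false.
    by rewrite -Lr => x [/KL].
  have K0 : K `&` O [::] !=set0 by exists x0.
  elim: r [::] K0 KL rK {Lr} => [|x r IH] s Ks rs rK.
    by have [y /rs[]] := Ks.
  have [xs|/existsNP[s' /not_implyP[s's /not_implyP[Ks' nx]]]] :=
      pselect (forall s', O s' `<=` O s -> K `&` O s' !=set0 ->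
        K `&` (O s' `&` pair_side (P x) false) !=set0).
    by exists x, s; split => //; apply: rK; rewrite mem_head.
  apply: (IH s') => // [y [Ky Oy]|y yr]; last by apply: rK; rewrite inE yr orbT.
  have [|z /=] := rs y; first by split => //; exact: s's.
  rewrite inE => /predU1P[-> Py|zr Pz]; last by exists z.
  by case: nx; exists y.
have [iM Mmax] := MP _ Ks0; set S := O s0 in iM Mmax s0P Ks0.
have comb (e : pairs X -> bool) N : N `<=` M S -> finite_set N ->
    exists s, O s = S `&` \bigcap_(J in N) pair_side J (e J).
  move=> NM fN; have /finite_seqP[l lN] : finite_set [set (c S J, e J) | J in N].
    exact: finite_image.
  exists (l :: s0) => /=; rewrite -lN bigcap_image -/S.
  apply/seteqP; split=> y [Sy Ny]; split => // J NJ.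
    have [J' /= [MJ' cJ']] := Ny J NJ.
    by rewrite (cP _ Ks0 _ _ MJ' (NM _ NJ) cJ').
  by exists J; [split => //; exact: NM | exact: Ny].
(* The true side of [P x] meets the refinements of [S] by the choice of [P], the false side by the
   choice of [s0]. *)
have iP : independent K S (M S `|` [set P x]).
  move=> e N NM fN.
  have [s Os] := @comb e (N `&` M S) (@subIsetr _ _ _) (finite_setIl _ fN).
  have Ks : K `&` O s !=set0.
    by rewrite Os; apply: iM; [exact: subIsetr | exact: finite_setIl].
  have [y [Ky [Oy Py]]] : K `&` (O s `&` pair_side (P x) (e (P x))) !=set0.
    case: (e (P x)); first by have [_] := PP x Kx; exact.
    by apply: s0P => //; rewrite Os => y [].
  move: Oy; rewrite Os => -[Sy Ny].
  exists y; split => //; split => // J NJ; case: (NM J NJ) => [MJ|-> //].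
  exact: Ny.
have MP' : M S (P x).
  apply: contrapT => nM; apply: (Mmax (M S `|` [set P x])) => //.
  by split; [left | move=> /(_ (P x) (or_intror erefl))].
have PM : [set P x] `<=` M S by move=> _ ->.
(* Refining [S] by the true side of [P x] gives a set that the false side misses, against the choice
   of [s0]. *)
have [s Os] := @comb (fun=> true) _ PM (finite_set1 _).
have [||y [Ky []]] := s0P s.
- by rewrite Os => y [].
- by rewrite Os; apply: iM => //; exact: finite_set1.
- by rewrite Os bigcap_set1 => -[_]; exact: pair_side_disjoint.
Qed.

(** * A subseparable closed G_delta *)

(** Around a point of [K] in each [U i] a tower [O i] is built inside [U i]. The closures of the
    sets [O i m] cut with [Q m] decrease into [U i] cut with [K], so by compactness one of these
    sets lies in any open [V] containing the latter. *)
Lemma pi_base_at_Gdelta (X : topologicalType) (K : set X) (x : X)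
    (U : nat -> set X) :
  compactum X -> closed_Gdelta K -> pi_base_at K x U ->
  exists U', pi_base_at setT x U'.
Proof.
move=> cX [Q tQ KQ] [UK Ux].
have /choice[O OP] : forall i, exists O, [/\ tower O, O 0 `<=` U i &
    forall m, O m `&` Q m !=set0].
  move=> i; have [oU [w [Kw Uw]]] := UK i.
  have [O [tO Ow OU]] := compactum_tower cX oU Uw.
  exists O; split => // m; exists w; split => //.
  by move: Kw; rewrite KQ; apply.
pose U' n := let p := odflt (0, 0) (unpickle n) in O p.1 p.2 `&` Q p.2.
exists U'; split=> [n|V oV Vx].
  rewrite /U'; case: (odflt _ _) => i m /=; have [tO _ OQ] := OP i.
  split; last by rewrite setTI.
  by apply: openI; [case: (tO m) | case: (tQ m)].
have [i iV] := Ux V oV Vx; have [tO OU _] := OP i.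
apply: contrapT => noV.
have OQ m n : (m <= n)%N -> O i n `&` Q n `<=` O i m `&` Q m.
  by move=> mn y [/(tower_sub tO mn) Oy /(tower_sub tQ mn) Qy].
have [|||m _|m n _ _|y [nVy yOQ]] := @compact_bigcap_directed X (~` V) nat setT
    (fun m => closure (O i m `&` Q m)).
- by apply: compactum_closed => //; exact: open_closedC.
- by exists 0.
- by move=> m _; exact: closed_closure.
- apply: contrapT => nVO; apply: noV; exists (pickle (i, m)).
  rewrite /U' pickleK /= setTI => y Oy; apply: contrapT => nVy.
  by apply: nVO; exists y; split => //; exact: subset_closure.
- exists (maxn m n) => //.
  rewrite subsetI; split; apply: closureS; apply: OQ; first exact: leq_maxl.
  exact: leq_maxr.
- apply: nVy; apply: iV; split.
    rewrite KQ => m _; apply: (proj2 (tQ m)).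
    by apply: closureS (yOQ m.+1 Logic.I) => z [].
  apply: OU; apply: (proj2 (tO 0)).
  by apply: closureS (yOQ 1 Logic.I) => z [].
Qed.

Lemma pi_base_at_dense (X : topologicalType) (x : X) (U : nat -> set X)
    (S : set X) :
  pi_base_at setT x U -> dense S ->
  exists T : nat -> X, (forall k, S (T k)) /\ closure (range T) x.
Proof.
move=> [oU Ux] dS.
have /choice[T TP] : forall k, exists t, U k t /\ S t.
  by move=> k; have [oUk +] := oU k; rewrite setTI => /dS /(_ oUk)[t]; exists t.
exists T; split=> [k|V]; first by case: (TP k).
rewrite nbhsE => -[W [oW Wx] WV]; have [k] := Ux W oW Wx.
rewrite setTI => kW; exists (T k); split; first by exists k.
by apply/WV/kW; case: (TP k).
Qed.

Lemma closed_Gdelta_bigcap_countable (X : topologicalType) (I : Type)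
    (B : set I) (G : I -> set X) :
  countable B -> (forall i, B i -> closed_Gdelta (G i)) ->
  closed_Gdelta (\bigcap_(i in B) G i).
Proof.
move=> /countable_injP[f fI] gG.
have -> : \bigcap_(i in B) G i = \bigcap_n \bigcap_(i in [set i | B i /\ f i = n]) G i.
  apply/seteqP; split=> [x Gx n _ i [Bi _]|x Gx i Bi]; first exact: Gx.
  by apply: (Gx (f i)).
apply: closed_Gdelta_bigcap => n.
have [[i [Bi fin]]|noi] := pselect (exists i, B i /\ f i = n).
  rewrite (_ : [set _ | _] = [set i]) ?bigcap_set1; first exact: gG.
  apply/seteqP; split=> [j [Bj fj]|_ -> //].
  by apply: fI; rewrite ?inE // fin.
rewrite (_ : [set _ | _] = set0) ?bigcap_set0; last first.
  by apply/seteqP; split=> // j ?; apply: noi; exists j.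
exists (fun=> setT) => [n'|]; first by split; [exact: openT|].
by rewrite bigcapT.
Qed.

(* A chain of pairs (countable set, closed G_delta off its closure), each
   step adding countable subsets of every [D n] that accumulate at a common
   point of the previous G_delta, plays the role of a sequence of length
   omega_1 when it is maximal: no countable part of it is cofinal. *)
Lemma subseparable_Gdelta (X : topologicalType) (D : nat -> set X) :
  compactum X -> (forall n, ctight (D n)) -> \bigcup_n D n = setT ->
  (forall n, dense (D n)) -> [set: X] !=set0 ->
  exists G S : set X, [/\ closed_Gdelta G, G !=set0, countable S & G `<=` closure S].
Proof.
move=> cX tD DT dD X0; apply: contrapT => noGS.
have ext (S G : set X) : countable S -> closed_Gdelta G -> G !=set0 ->
    exists t : set X * set X,
    [/\ [/\ countable t.1, closed_Gdelta t.2, t.2 !=set0 &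
            t.2 `&` closure t.1 = set0],
        S `<=` t.1, t.2 `<=` G &
        exists2 y, G y & forall n, closure (t.1 `&` D n) y].
  move=> cS gG G0.
  have [y Gy [U Uy]] :=
    sigma_ctight_pi_base cX tD DT (closed_Gdelta_closed gG) G0.
  have [U' {}Uy] := pi_base_at_Gdelta cX gG Uy.
  have /choice[T TP] := fun n => pi_base_at_dense Uy (dD n).
  pose S' := S `|` \bigcup_n range (T n).
  have cS' : countable S'.
    apply: countableU => //; apply: bigcup_countable => // n _.
    exact: (card_le_trans (card_image_le _ _)).
  have [w [Gw nSw]] : G `&` ~` closure S' !=set0.
    apply: contrapT => GS; apply: noGS; exists G, S'; split => // w Gw.
    by apply: contrapT => nSw; apply: GS; exists w.
  have oS' : open (~` closure S') by exact/closed_openC/closed_closure.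
  have [Q [tQ Qw QS]] := compactum_tower cX oS' nSw.
  exists (S', G `&` \bigcap_n Q n); split => /=.
  - split => //; first by apply: closed_GdeltaI => //; exists Q.
      by exists w; split => // n _; exact: Qw.
    by apply/seteqP; split=> // v [[_ /(_ 0 Logic.I)/QS]].
  - by left.
  - by move=> ? [].
  - exists y => // n; apply: closureS (proj2 (TP n)) => _ [k _ <-].
    by split; [right; exists n | case: (TP n)].
pose good (s : set X * set X) := [/\ countable s.1, closed_Gdelta s.2, s.2 !=set0 &
  s.2 `&` closure s.1 = set0].
pose R (s t : set X * set X) := [/\ s.1 `<=` t.1, t.2 `<=` s.2 &
  exists2 y, s.2 y & forall n, closure (t.1 `&` D n) y].
have Rtrans s t u : R s t -> R t u -> R s u.
  move=> [st ts [y sy ty]] [tu ut _]; split.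
  - exact: subset_trans tu.
  - exact: subset_trans ts.
  - by exists y => // n; apply: closureS (ty n); exact: setSI.
pose P (C : set (set X * set X)) := C `<=` good /\
  forall s t, C s -> C t -> [\/ s = t, R s t | R t s].
have [C [[Cg CR] Cmax]] : exists C, P C /\ forall C', C `<` C' -> ~ P C'.
  apply: Zorn_bigcup => F FP Ftot; split; first by move=> s [C /FP[+ _]]; apply.
  move=> s t [B FB Bs] [C FC Ct]; have [BC|CB] := Ftot _ _ FB FC.
    by apply: (proj2 (FP _ FC)) => //; exact: BC.
  by apply: (proj2 (FP _ FB)) => //; exact: CB.
have clC s : C s -> closed s.2 by move=> /Cg[_ /closed_Gdelta_closed].
(* Every countable part of the chain is bounded in it: otherwise [ext], applied to the union of the
   first components and the intersection of the second, gives a pair above all of [C], against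
   maximality. *)
have ub B : countable B -> B `<=` C -> exists2 c, C c & forall b, B b -> R b c.
  move=> cB BC; apply: contrapT => nub.
  have G0 : \bigcap_(b in B) b.2 !=set0.
    have [B0|/set0P B0] := eqVneq B set0.
      by have [x _] := X0; exists x; rewrite B0.
    have [|b Bb|b b' Bb Bb'|x [_ ?]] := @compact_bigcap_directed X setT _ B
        (fun b => b.2) (proj1 cX) B0.
    - by move=> b /BC; exact: clC.
    - by rewrite setTI; case: (Cg _ (BC _ Bb)).
    - have [->|[_ b'b _]|[_ bb' _]] := CR _ _ (BC _ Bb) (BC _ Bb').
      + by exists b'.
      + by exists b' => // y b'y; split => //; exact: b'b.
      + by exists b => // y b'y; split => //; exact: bb'.
    - by exists x.
  have [|||t [tg St tG [y Gy ty]]] := ext (\bigcup_(b in B) b.1) (\bigcap_(b in B) b.2).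
  - by apply: bigcup_countable => // b /BC/Cg[].
  - by apply: closed_Gdelta_bigcap_countable => // b /BC/Cg[].
  - by [].
  have Bt b : B b -> R b t.
    move=> Bb; split.
    - by move=> x bx; apply: St; exists b.
    - by move=> x /tG; exact.
    - by exists y => //; exact: Gy.
  have nCt : ~ C t by move=> Ct; apply: nub; exists t.
  have Ct c : C c -> R c t.
    move=> Cc; apply: contrapT => nct; apply: nub; exists c => // b Bb.
    have [bc|//|cb] := CR _ _ (BC _ Bb) Cc.
      by case: nct; rewrite -bc; exact: Bt.
    by case: nct; apply: Rtrans cb _; exact: Bt.
  apply: (Cmax (C `|` [set t])).
    by split; [left | move=> /(_ t (or_intror erefl))].
  split=> [s [/Cg //|-> //]|s u [Cs|->] [Cu|->]].
  - exact: CR.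
  - by apply: Or32; exact: Ct.
  - by apply: Or33; exact: Ct.
  - exact: Or31.
have /choice[y yP] : forall c, exists y, C c -> c.2 y /\
    forall n, closure ((\bigcup_(d in C) d.1) `&` D n) y.
  move=> c; have [Cc|nCc] := pselect (C c); last by have [x _] := X0; exists x.
  have [||d Cd cd] := ub [set c]; [exact: countable1 | by move=> _ -> |].
  have [_ _ [z cz dz]] := cd c erefl; exists z => _; split => // n.
  by apply: closureS (dz n); apply: setSI => x dx; exists d.
have C0 : C !=set0 by have [||c Cc _] := ub set0; last by exists c.
(* [Y c] is the tail of the points [y] from [c] on; [z] lies in the closure of every tail, hence in
   every [c.2]. *)
pose Y c := [set y d | d in [set d | C d /\ (d = c \/ R c d)]].
have [|c Cc|b c Cb Cc|z [_ zY]] := @compact_bigcap_directed X setT _ C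
    (fun c => closure (Y c)) (proj1 cX) C0.
- by move=> c _; exact: closed_closure.
- by rewrite setTI; exists (y c); apply: subset_closure; exists c => //; split; [|left].
- have YR b' c' : R b' c' -> Y c' `<=` Y b'.
    move=> bc _ [d [Cd cd] <-]; exists d => //; split => //; right.
    by case: cd => [->//|]; exact: Rtrans.
  have [->|bc|cb] := CR _ _ Cb Cc.
  + by exists c.
  + by exists c => //; rewrite subsetI; split => //; apply: closureS; exact: YR.
  + by exists b => //; rewrite subsetI; split => //; apply: closureS; exact: YR.
have zC c : C c -> c.2 z.
  move=> Cc; apply: (clC _ Cc); apply: closureS (zY c Cc) => _ [d [Cd cd] <-].
  have [dy _] := yP _ Cd.
  by case: cd => [<- //|[_ dc _]]; exact: dc.
(* Tightness of the piece containing [z] leaves a countable set [E], which by [ub] lies in a single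
   [c0.1]; but [z] is in [c0.2], which misses the closure of [c0.1]. *)
have [n _ Dz] : (\bigcup_n D n) z by rewrite DT.
have [||E [EC cE clE]] := tD n ((\bigcup_(d in C) d.1) `&` D n) z _ Dz.
- by move=> x [].
- have [c Cc] := C0; apply: closed_closure; apply: closureS (zY c Cc).
  by move=> _ [d [Cd _] <-]; case: (yP _ Cd).
have /choice[c cP] : forall e, exists c, E e -> C c /\ c.1 e.
  move=> e; have [/EC[[c Cc ce] _]|nE] := pselect (E e); first by exists c.
  by exists (set0, set0).
have [||c0 Cc0 c0P] := ub (c @` E).
- exact: (card_le_trans (card_image_le _ _)).
- by move=> _ [e /cP[? _] <-].
have [_ _ _ c00] := Cg _ Cc0.
rewrite -[False]/(set0 z) -c00; split; first exact: zC.
apply: closureS clE => e Ee; have [Cce ce] := cP e Ee.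
by have [+ _ _] := c0P (c e) (imageP _ Ee); apply.
Qed.

(** * Closing off under countable operations *)

(** Terms with countably many arguments at each node: their values form the closure of [x0] under
    the operations. *)
Inductive op_tree (T : Type) : Type :=
| OpLeaf : op_tree T
| OpNode : T -> set nat -> (nat -> op_tree T) -> op_tree T.

Arguments OpLeaf {T}.

Fixpoint op_tree_eval (X T : Type) (x0 : X)
    (op : T -> set nat -> (nat -> X) -> X) (t : op_tree T) : X :=
  if t is OpNode a A f then op a A (fun k => op_tree_eval x0 op (f k)) else x0.

(* The labels met along each branch determine a well-founded countably
   branching tree: this bounds the number of trees without transfinite
   induction. *)
Fixpoint op_tree_code (T : Type) (t : op_tree T) (p : seq nat * (T + nat)) : Prop :=
  if t is OpNode a A f then
    match p with
    | ([::], inl b) => b = a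
    | ([::], inr n) => A n
    | (k :: u, l) => op_tree_code (f k) (u, l)
    end
  else False.

Lemma op_tree_code_inj (T : Type) : injective (@op_tree_code T).
Proof.
elim=> [|a A f IH] [|b B g] E.
- by [].
- by have := congr1 (@^~ ([::], inl b)) E; rewrite /= => E'; have : False by rewrite E'.
- by have := congr1 (@^~ ([::], inl a)) E; rewrite /= => E'; have : False by rewrite -E'.
have -> : a = b.
  by have := congr1 (@^~ ([::], inl a)) E; rewrite /= => E'; rewrite -E'.
have -> : A = B.
  by apply/funext => n; exact: (congr1 (@^~ ([::], inr n)) E).
congr OpNode; apply/funext => k; apply: IH; apply/funext => -[u l].
exact: (congr1 (@^~ (k :: u, l)) E).
Qed.

(** The values of trees are closed under [op], and injective codes in a countable type index the
    trees by sets of natural numbers. *)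
Lemma countably_closed_image (X : Type) (T : countType) (x0 : X)
    (op : T -> set nat -> (nat -> X) -> X) :
  exists m : set nat -> X, forall a A (s : nat -> X),
    (forall k, range m (s k)) -> range m (op a A s).
Proof.
pose code (t : op_tree T) := pickle @` op_tree_code t.
have codeI : injective code.
  move=> t u tu; apply: op_tree_code_inj; apply/funext => p; apply/propext.
  have sub t' u' : code t' = code u' -> op_tree_code t' p -> op_tree_code u' p.
    move=> tu' tp; have : code u' (pickle p) by rewrite -tu'; exists p.
    by move=> [q uq /(pcan_inj (@pickleK _)) <-].
  by split; exact: sub.
have [m mE] : exists m, forall t, m (code t) = op_tree_eval x0 op t.
  have /choice[m mP] : forall B : set nat, exists x, forall t, code t = B ->
      x = op_tree_eval x0 op t.
    move=> B; have [[t tB]|nB] := pselect (exists t, code t = B).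
      by exists (op_tree_eval x0 op t) => u; rewrite -tB => /codeI ->.
    by exists x0 => t tB; case: nB; exists t.
  by exists m => t; exact: mP.
have [m' m'E] : exists m' : set nat -> X,
    range m' = range (op_tree_eval x0 op).
  pose m' B := if `[< range code B >] then m B else x0.
  exists m'; apply/seteqP; split=> [_ [B _ <-]|_ [t _ <-]].
    rewrite /m'; case: asboolP => [[t _ <-]|_]; first by exists t.
    by exists OpLeaf.
  by exists (code t) => //; rewrite /m'; case: asboolP => // -[]; exists t.
exists m' => a A s; rewrite m'E => sm.
have /choice[f fP] : forall k, exists t, op_tree_eval x0 op t = s k.
  by move=> k; have [t _ ?] := sm k; exists t.
by exists (OpNode a A f) => //=; congr op; apply/funext.
Qed.

(** Near [z] the points of [B] lie in [P n.+1], hence in [Q n.+1], whose closure is inside [Q n]. *)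
Lemma tower_trace (X : topologicalType) (P Q : nat -> set X) (B : set X) (z : X) :
  tower P -> tower Q -> closure B z -> (forall n, P n z) ->
  (forall n, P n `&` B `<=` Q n) -> forall n, Q n z.
Proof.
move=> tP tQ Bz Pz PQ n; apply: (proj2 (tQ n)) => V Vz.
have PV : nbhs z (P n.+1 `&` V).
  by apply: filterI => //; apply: open_nbhs_nbhs; split => //; case: (tP n.+1).
have [y [By [Py Vy]]] := Bz _ PV.
by exists y; split => //; exact: PQ.
Qed.

(* [O x] shrinks to a G_delta containing [x] inside the closure of the range of
   [S x]; the last operation below picks, for every sequence [s] and every
   possible trace [A], one point [w] of the closure of [s] whose tower has trace
   [A] on [s]. Points with equal traces lie in each other's G_delta, so
   continuum many G_deltas cover the closure of [s]. *)
Lemma subseparable_cover_dense (X : topologicalType) (D : nat -> set X)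
    (O : X -> nat -> set X) (S : X -> nat -> X) (T : X -> nat -> nat -> X) :
  compactum X -> (forall n, ctight (D n)) -> \bigcup_n D n = setT ->
  [set: X] !=set0 -> (forall x, tower (O x)) -> (forall x n, O x n x) ->
  (forall x, \bigcap_n O x n `<=` closure (range (S x))) ->
  (forall x n k, D n (T x n k)) -> (forall x n, closure (range (T x n)) x) ->
  exists m : set nat -> X, closure (range m) = setT.
Proof.
move=> cX tD DT [x0 _] tO Ox OS DTx Tx.
pose op (a : (nat + nat * nat) + option (seq (nat * nat))) (A : set nat)
    (s : nat -> X) : X :=
  match a with
  | inl (inl k) => S (s 0) k
  | inl (inr (n, k)) => T (s 0) n k
  | inr (Some l) => xget x0 [set q | forall p, p \in l -> ~ O (s p.1) p.2 q]
  | inr None => xget x0 [set w | closure (range s) w /\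
      forall n k, O w n (s k) <-> A (pickle (n, k))]
  end.
have [m mop] := countably_closed_image x0 op; exists m.
have mS x k : range m x -> range m (S x k).
  by move=> mx; exact: (mop (inl (inl k)) set0 (fun=> x)).
have mT x n k : range m x -> range m (T x n k).
  by move=> mx; exact: (mop (inl (inr (n, k))) set0 (fun=> x)).
have cover z : closure (range m) z -> exists2 x, range m x & forall n, O x n z.
  move=> mz; have [n _ Dz] : (\bigcup_n D n) z by rewrite DT.
  have [||B [BM cB Bz]] := tD n (range m `&` D n) z _ Dz; first by move=> x [].
    move=> V; rewrite nbhsE => -[W [oW Wz] WV].
    have [x [mx Wx]] := mz W (open_nbhs_nbhs (conj oW Wz)).
    have [_ [[k _ <-] Wk]] := Tx x n W (open_nbhs_nbhs (conj oW Wx)).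
    by exists (T x n k); split; [split => //; exact: mT | exact: WV].
  have [s Bs] : exists s : nat -> X, B = range s.
    by apply: countable_range => //; have [y [By _]] := Bz setT filterT; exists y.
  have ms k : range m (s k) by have [] := BM (s k); first by rewrite Bs; exists k.
  pose A := [set pickle nk | nk in [set nk : nat * nat | O z nk.1 (s nk.2)]].
  have := mop (inr None) A s ms; rewrite /op.
  case: xgetP => [w _ [sw wA] mw|/(_ z) nz].
    exists w => // i; apply: (@tower_trace X (O z) (O w) B) => // j y.
    rewrite Bs => -[Oy [k _ ky]]; rewrite -ky; apply/wA.
    by exists (j, k) => //=; rewrite ky.
  case: nz; split; first by rewrite -Bs.
  move=> i k; split; first by exists (i, k).
  by move=> [[i' k'] /= Ok /(pcan_inj (@pickleK _))[<- <-]].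
apply/seteqP; split=> // q _.
suff [x mx Oq] : exists2 x, range m x & forall n, O x n q.
  have := OS x q (fun n _ => Oq n); apply: closureS => _ [k _ <-].
  exact: mS.
(* If no G_delta given by a point of [range m] contains [q], finitely many open sets missing [q]
   cover the closure of [range m]; the operation [inr (Some l)] then picks a point of [range m]
   outside all of them. *)
apply: contrapT => nq.
have [|||L [LA /finite_seqP[r Lr] mL]] := @compact_finite_subcover X (closure (range m))
    (X * nat)%type [set p | range m p.1 /\ ~ O p.1 p.2 q] (fun p => O p.1 p.2).
- by apply: compactum_closed => //; exact: closed_closure.
- by move=> p _; case: (tO p.1 p.2).
- move=> z /cover[x mx Oz].
  have /existsNP[n nO] : ~ forall n, O x n q by move=> Oq; apply: nq; exists x.
  by exists (x, n).
pose d := (m set0, 0) : X * nat.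
have ms k : range m (nth d r k).1.
  have [kr|rk] := ltnP k (size r); last by rewrite nth_default //; exists set0.
  by have [] := LA (nth d r k); first by rewrite Lr /= mem_nth.
pose l := [seq (k, (nth d r k).2) | k <- iota 0 (size r)].
have := mop (inr (Some l)) set0 _ ms; rewrite /op.
case: xgetP => [w _ wl mw|/(_ q) nl].
  have [p] := mL w (subset_closure mw); rewrite Lr /= => pr Op.
  apply: (wl (index p r, p.2)); rewrite /= ?nth_index //.
  apply/mapP; exists (index p r); last by rewrite nth_index.
  by rewrite mem_iota /= index_mem.
case: nl => _ /mapP[k + ->] /=; rewrite mem_iota /= add0n => kr.
by have [] := LA (nth d r k); first by rewrite Lr /= mem_nth.
Qed.

(** * Powers *)

Lemma open_preimage (X Y : topologicalType) (f : X -> Y) (V : set Y) :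
  continuous f -> open V -> open (f @^-1` V).
Proof. by move=> cf; move: V; apply/continuousP. Qed.

Lemma omega_power_proj_continuous (X : topologicalType) (i : nat) :
  continuous ((fun z => z i) : omega_power X -> X).
Proof. exact: (@proj_continuous nat (fun=> X) i). Qed.

Lemma omega_power_proj_open (X : topologicalType) (i : nat) (V : set X) :
  open V -> open ([set z | V (z i)] : set (omega_power X)).
Proof. exact: (open_preimage (@omega_power_proj_continuous X i)). Qed.

(** The product topology is a supremum, so convergence of the filter of boxes to [z] can be checked
    on one coordinate at a time. *)
Lemma omega_power_nbhs_box (X : topologicalType) (z : omega_power X)
    (V : set (omega_power X)) :
  open V -> V z -> exists n (W : nat -> set X),
    (forall i, open (W i) /\ W i (z i)) /\
    forall y : omega_power X, (forall i, (i < n)%N -> W i (y i)) -> V y.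
Proof.
move=> oV Vz.
pose B := [set p : nat * (nat -> set X) | forall i, open (p.2 i) /\ p.2 i (z i)].
pose G (p : nat * (nat -> set X)) : set (omega_power X) :=
  [set y | forall i, (i < p.1)%N -> p.2 i (y i)].
have FG : Filter (filter_from B G).
  apply: filter_from_filter.
    by exists (0, fun=> setT) => i; split => //; exact: openT.
  move=> [m U] [n W] BU BW; exists (maxn m n, fun i => U i `&` W i).
    by move=> i; have [? ?] := BU i; have [? ?] := BW i; split => //; exact: openI.
  move=> y /= yUW; split=> i lti; have [] := yUW i; rewrite // (leq_trans lti) //.
    exact: leq_maxl.
  exact: leq_maxr.
have Gz : filter_from B G --> z.
  apply/cvg_sup => i A; rewrite nbhsE => -[_ [[U oU <-] Uz] UA].
  exists (i.+1, fun j => if j == i then U else setT).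
    by move=> j /=; case: eqP => [->|_]; split => //; exact: openT.
  by move=> y yG; apply: UA; have := yG i (ltnSn i); rewrite /= eqxx.
have [[n W] BW GV] := Gz V (open_nbhs_nbhs (conj oV Vz)).
by exists n, W; split.
Qed.

Lemma omega_power_dense (X : topologicalType) (S : set X)
    (V : set (omega_power X)) :
  dense S -> open V -> V !=set0 -> exists2 z : omega_power X, V z & forall i, S (z i).
Proof.
move=> dS oV [z Vz]; have [n [W [Wz WV]]] := omega_power_nbhs_box oV Vz.
have /choice[y yP] : forall i, exists t, W i t /\ S t.
  move=> i; have [oW Wzi] := Wz i.
  by have [t ?] := dS _ (ex_intro _ _ Wzi) oW; exists t.
by exists y => [|i]; [apply: WV => i _; case: (yP i) | case: (yP i)].
Qed.

Lemma omega_power_pi_base (X : topologicalType) (p : X) (U : nat -> set X) :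
  pi_base_at setT p U ->
  exists B, pi_base_at setT ((fun=> p) : omega_power X) B.
Proof.
move=> [UT Up].
pose B n : set (omega_power X) := let s := odflt [::] (unpickle n) in
  \bigcap_(i in `I_(size s)) [set z | U (nth 0 s i) (z i)].
exists B; split=> [n|V oV Vp].
  split.
    apply: open_bigcap_finite; first exact: finite_II.
    move=> i _; apply: omega_power_proj_open.
    by case: (UT (nth 0 (odflt [::] (unpickle n)) i)).
  have /choice[t tU] : forall k, exists t, U k t.
    by move=> k; have [_ [t [_ ?]]] := UT k; exists t.
  by exists (fun i => t (nth 0 (odflt [::] (unpickle n)) i)); split => // i _; exact: tU.
have [n [W [Wp WV]]] := omega_power_nbhs_box oV Vp.
have /choice[k kP] : forall i, exists k, U k `<=` W i.
  move=> i; have [oW Wpi] := Wp i; have [k] := Up _ oW Wpi.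
  by rewrite setTI; exists k.
exists (pickle (mkseq k n)) => z [_]; rewrite /B pickleK /= size_mkseq => Bz.
by apply: WV => i lti; apply: kP; have := Bz i lti; rewrite /= nth_mkseq.
Qed.

Lemma omega_power_constr_continuous (X : topologicalType) (x : X) :
  continuous ((fun y i => if i == 0 then y else x) : X -> omega_power X).
Proof.
move=> y A; rewrite nbhsE => -[V [oV Vy] VA].
have [n [W [Wy WV]]] := omega_power_nbhs_box oV Vy.
have [oW0 Wy0] := Wy 0.
apply: filterS (open_nbhs_nbhs (conj oW0 Wy0)) => t Wt.
apply/VA/WV => i _; case: eqP => [-> //|/eqP i0].
by have [_] := Wy i; rewrite (negPf i0).
Qed.

Lemma closed_Gdelta_preimage (X Y : topologicalType) (f : X -> Y) (G : set Y) :
  continuous f -> closed_Gdelta G -> closed_Gdelta (f @^-1` G).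
Proof.
move=> cf [Q tQ ->]; exists (fun n => f @^-1` Q n); last by rewrite preimage_bigcap.
move=> n; have [oQ Qn] := tQ n; split; first exact: open_preimage.
move=> y cly; apply: Qn => V /cf /cly[t [Qt Vt]].
by exists (f t).
Qed.

(** One pi-base at the constant point [p] is moved by homeomorphisms to all constant points, with
    common indices. Pulled back, the conditions at [x] and [y] become one neighbourhood of that
    point, so one [k] serves both. *)
Lemma homogeneous_omega_pi_base (X : topologicalType) (p : X) (U : nat -> set X) :
  homogeneous (omega_power X) -> pi_base_at setT p U ->
  exists E : X -> nat -> set (omega_power X),
    (forall x k, open (E x k) /\ E x k !=set0) /\
    forall x y (V W : set X), open V -> open W -> V x -> W y ->
      exists k, (forall z, E x k z -> V (z 0)) /\ (forall z, E y k z -> W (z 0)).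
Proof.
move=> hX /omega_power_pi_base[B [BT Bp]].
pose c (x : X) : omega_power X := fun=> x.
have /choice[h hP] : forall x, exists hg : (omega_power X -> omega_power X) *
    (omega_power X -> omega_power X), [/\ continuous hg.1, continuous hg.2,
      cancel hg.1 hg.2, cancel hg.2 hg.1 & hg.1 (c p) = c x].
  move=> x; have [h [[ch [g [cg hK gK]]] hx]] := hX (c p) (c x).
  by exists (h, g).
exists (fun x k => (h x).2 @^-1` B k); split=> [x k|x y V W oV oW Vx Wy].
  have [_ cg hK _ _] := hP x; have [oB [b [_ Bb]]] := BT k; split.
    exact: open_preimage.
  by exists ((h x).1 b); rewrite /= hK.
have [chx _ _ gKx hx] := hP x; have [chy _ _ gKy hy] := hP y.
have [||k] := Bp ((h x).1 @^-1` [set z | V (z 0)] `&` (h y).1 @^-1` [set z | W (z 0)]).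
- apply: openI.
    by apply: (open_preimage chx); exact: omega_power_proj_open.
  by apply: (open_preimage chy); exact: omega_power_proj_open.
- by split; rewrite /= ?hx ?hy.
- rewrite setTI => kVW; exists k; split=> z /= /kVW[/=].
    by rewrite gKx.
  by rewrite gKy.
Qed.

(** A homeomorphism moves the power of [G] to a closed G_delta around the constant point [x]; [j]
    embeds [X] as a slice through this point, and [H] is the trace on the slice. The sequence lists
    first coordinates of images of the [r u], eventually constant sequences of points of [S]. *)
Lemma homogeneous_omega_subseparable (X : topologicalType) (G S : set X) (x : X) :
  homogeneous (omega_power X) -> closed_Gdelta G -> G !=set0 -> countable S ->
  G `<=` closure S ->
  exists H (s : nat -> X), [/\ closed_Gdelta H, H x & H `<=` closure (range s)].
Proof.
move=> hX gG [q Gq] cS GS.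
have [|t St] := countable_range cS.
  by have [y [Sy _]] := GS q Gq setT filterT; exists y.
have [h [[ch [g [cg hK gK]]] hx]] := hX (fun=> q) (fun=> x).
pose j (y : X) : omega_power X := fun i => if i == 0 then y else x.
have jx : j x = (fun=> x) by apply/funext => i; rewrite /j; case: eqP.
have cj : continuous (fun y => g (j y)).
  by move=> y; apply: continuous_comp; [exact: omega_power_constr_continuous | exact: cg].
pose r (u : seq nat) : omega_power X := fun i => t (nth 0 u i).
exists (\bigcap_i ((fun y => g (j y) i) @^-1` G)).
exists (fun k => h (r (odflt [::] (unpickle k))) 0); split.
- apply: closed_Gdelta_bigcap => i; apply: closed_Gdelta_preimage => // y.
  apply: (@continuous_comp _ (omega_power X) _ (fun y => g (j y)) (fun z => z i)).
    exact: cj.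
  exact: omega_power_proj_continuous.
- by move=> i _; rewrite /= jx -hx hK.
move=> y Gy A; rewrite nbhsE => -[V [oV Vy] VA].
have oV' : open (h @^-1` [set z | V (z 0)]).
  by apply: (open_preimage ch); exact: omega_power_proj_open.
have Vgy : (h @^-1` [set z | V (z 0)]) (g (j y)) by rewrite /= gK.
have [n [W [Wy WV]]] := omega_power_nbhs_box oV' Vgy.
have /choice[k kP] : forall i, exists k, W i (t k).
  move=> i; have [oW Wyi] := Wy i.
  have [w [+ Ww]] := GS _ (Gy i Logic.I) _ (open_nbhs_nbhs (conj oW Wyi)).
  by rewrite St => -[k _ kw]; exists k; rewrite kw.
exists (h (r (mkseq k n)) 0); split; first by exists (pickle (mkseq k n)); rewrite ?pickleK.
by apply/VA/WV => i lti; rewrite /r nth_mkseq.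
Qed.

Theorem theorem4p1 (X : topologicalType) (D : set (set X)) :
  compactum X ->
  countable D ->
  \bigcup_(S in D) S = [set: X] ->
  (forall S : set X, D S -> countably_tight_subspace S /\ dense S) ->
  homogeneous (omega_power X) ->
  [set: X] #<= [set: set nat].
Proof.
move=> cX cD DT DP hX.
have [X0|/set0P X0] := eqVneq [set: X] set0; first by rewrite X0; exact: card_ge0.
have [|d Dd] := countable_range cD.
  have [x _] := X0; have [S DS _] : (\bigcup_(S in D) S) x by rewrite DT.
  by exists S.
have dD n : D (d n) by rewrite Dd; exists n.
have td n : ctight (d n).
  by apply: countably_tight_subspace_ctight; case: (DP _ (dD n)).
have dd n : dense (d n) by case: (DP _ (dD n)).
have dT : \bigcup_n d n = setT.
  apply/seteqP; split=> // x _; have : (\bigcup_(S in D) S) x by rewrite DT.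
  by rewrite Dd => -[_ [n _ <-] ?]; exists n.
have [p _ [U Up]] := sigma_ctight_pi_base cX td dT closedT X0.
have [E [ET Exy]] := homogeneous_omega_pi_base hX Up.
have [G [S [gG G0 cS GS]]] := subseparable_Gdelta cX td dT dd X0.
have /choice[O OP] : forall x, exists Os : (nat -> set X) * (nat -> X),
    [/\ tower Os.1, forall n, Os.1 n x & \bigcap_n Os.1 n `<=` closure (range Os.2)].
  move=> x.
  have [H [s [[Q tQ HQ] Hx Hs]]] := homogeneous_omega_subseparable x hX gG G0 cS GS.
  by exists (Q, s); split => //=; [move=> n; move: Hx; rewrite HQ; exact | rewrite -HQ].
(* Every [E x k] contains a point with all coordinates in [d n]; its first coordinate is the [k]-th
   term, and [x] is in the closure of these terms. *)
have /choice[T TP] : forall xn, exists t : nat -> X,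
    (forall k, d xn.2 (t k)) /\ closure (range t) xn.1.
  move=> [x n] /=.
  have /choice[t tP] : forall k, exists y, d n y /\ exists2 z, E x k z & z 0 = y.
    move=> k; have [oE E0] := ET x k; have [z Ez dz] := omega_power_dense (dd n) oE E0.
    by exists (z 0); split => //; exists z.
  exists t; split=> [k|A]; first by case: (tP k).
  rewrite nbhsE => -[V [oV Vx] VA]; have [k [EV _]] := Exy x x V V oV oV Vx Vx.
  exists (t k); split; first by exists k.
  by have [_ [z Ez <-]] := tP k; exact/VA/EV.
have [|||||m mT] := @subseparable_cover_dense X d (fun x => (O x).1)
    (fun x => (O x).2) (fun x n => T (x, n)) cX td dT X0.
- by move=> x; case: (OP x).
- by move=> x; case: (OP x).
- by move=> x; case: (OP x).
- by move=> x n k; case: (TP (x, n)).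
- by move=> x n; case: (TP (x, n)).
have dm : dense (range m).
  move=> V [x Vx] oV; have : closure (range m) x by rewrite mT.
  by move=> /(_ V (open_nbhs_nbhs (conj oV Vx)))[y [? ?]]; exists y.
have /choice[c cP] : forall xk, exists A : set nat,
    exists2 z, E xk.1 xk.2 z & z 0 = m A.
  move=> [x k] /=; have [oE E0] := ET x k.
  by have [z Ez /(_ 0)[A _ mA]] := omega_power_dense dm oE E0; exists A, z.
(* [f x] codes the whole sequence of sets [c (x, k)] by one set of natural numbers. *)
pose f x : set nat := [set pickle kn | kn in [set kn : nat * nat | c (x, kn.1) kn.2]].
suff fI : {in [set: X] &, injective f}.
  by rewrite -(card_le_eql (inj_card_eq fI)); exact: card_leT.
move=> x y _ _ fxy; apply: contrapT => /eqP xy.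
have cxy k : c (x, k) = c (y, k).
  have sub u v : f u = f v -> c (u, k) `<=` c (v, k).
    move=> fuv n cn; have : f v (pickle (k, n)) by rewrite -fuv; exists (k, n).
    by move=> [[k' n'] /= ? /(pcan_inj (@pickleK _))[<- <-]].
  by apply/seteqP; split; exact: sub.
have := proj2 cX; rewrite open_hausdorff => /(_ x y xy)[[V W] /= [Vx Wy] [oV oW VW]].
(* A common index [k] puts the same point [m (c (x, k))] into the disjoint sets [V] and [W]. *)
have [k [EV EW]] := Exy x y V W oV oW (set_mem Vx) (set_mem Wy).
have [z Ez zm] := cP (x, k); have [w Ew wm] := cP (y, k).
rewrite -[False]/(set0 (z 0)) -(eqP VW); split; first exact: EV.
by rewrite zm cxy -wm; exact: EW.
Qed.
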